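(* There is an absolute constant $c>0$ such that for all sufficiently large $n$ the following holds. Let $Q_1,\dots,Q_n\colon\mathbb{F}_2^m\to\mathbb{F}_2$ be polynomials of degree at most $2$, and let $\mathcal{Q}$ be the distribution of $(Q_1(X),\dots,Q_n(X))$ for $X$ uniform on $\mathbb{F}_2^m$. Then \[ \|\mathcal{Q}-\mathrm{Ber}(1/3)^{\otimes n}\|_{\mathtt{TV}}\ \ge\ 1-n^{-c/\log\log n}. \]
   Context: Logarithms are base 2. Total variation distance: $\|\mathcal{D}_1-\mathcal{D}_2\|_{\mathtt{TV}}=\frac12\sum_x|\mathcal{D}_1(x)-\mathcal{D}_2(x)|$; $\mathrm{Ber}(1/3)^{\otimes n}$ is the product of $n$ independent Bernoulli$(1/3)$ bits. *)

(* Defs.v *)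
From HB Require Import structures.
From mathcomp Require Import all_boot all_order all_algebra.
From mathcomp Require Import mpoly.
From mathcomp Require Import Rstruct.
From Stdlib Require Import Reals.

Set Implicit Arguments.
Unset Strict Implicit.
Unset Printing Implicit Defensive.

Import GRing.Theory Num.Theory.
Local Open Scope ring_scope.

(** A polynomial of degree at most 2 in m variables over F_2
    (msize = total degree + 1, msize 0 = 0). *)
Definition deg_le2 (m : nat) (p : {mpoly 'F_2[m]}) : bool := leq (msize p) 3.

Definition evalF2 (m : nat) (p : {mpoly 'F_2[m]}) (x : {ffun 'I_m -> 'F_2}) : 'F_2 :=
  p.@[fun i => x i].

Definition quad_distr (m n : nat) (Q : 'I_n -> {mpoly 'F_2[m]})
    (y : {ffun 'I_n -> 'F_2}) : R :=
  ((#|[set x : {ffun 'I_m -> 'F_2} | [forall i, evalF2 (Q i) x == y i]]|)%:R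
     / (2 ^+ m)).

Definition ber13n (n : nat) (y : {ffun 'I_n -> 'F_2}) : R :=
  (\prod_(i < n) (if y i == (1 : 'F_2) then 1 / 3 else 2 / 3)).

Definition tv_dist (T : finType) (D1 D2 : T -> R) : R :=
  (1 / 2 * \sum_(x : T) `|D1 x - D2 x|).

Definition log2 (x : R) : R := (ln x / ln 2).

(* Main.v *)
Require Import Defs.
From HB Require Import structures.
From mathcomp Require Import all_boot all_order all_algebra all_fingroup.
From mathcomp Require Import mpoly.
From mathcomp Require Import Rstruct.
From mathcomp Require ring lra zify.

(** Let [K] be of order log n / log log n.

    If some [K] of the [Q_i] have all nonempty partial sums of bias at most
    [2 ^- K], then by Fourier inversion their joint law is at most twice the
    uniform one, and a product bound on the Hellinger affinity finishes.
    Otherwise a maximal such family [J] has fewer than [K] elements, and every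
    other [Q_j] is a sum of members of [J] plus a quadratic [R_j] whose period
    group has codimension at most [2 K].  Conditioning on the values of [J]
    costs a factor [2 ^ K].

    One then conditions on the cosets of a subgroup [H] of codimension [w],
    at the price of a factor [2 ^ w], and looks for [t], a large multiple of
    [w + K], indices [j] such that the [R_j] are independent on every coset of
    [H].  A greedy choice either succeeds, or the common periods in [H] of the
    [R_j] already chosen form a smaller subgroup of codimension [O(K (w + K))]
    inside which the periods of every [R_j] have a smaller codimension.  After
    at most [2 K] failures all the [R_j] are constant on cosets; this uses
    [K ^ O(K) <= n] indices.
    Finally each factor is bounded away from 1 since the squared bias of a
    quadratic is 0 or a power of 2, never (1/3)^2. *)

Set Implicit Arguments.
Unset Strict Implicit.
Unset Printing Implicit Defensive.

Module QuadraticSources.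

Import ring lra zify.
Import Order.TTheory GRing.Theory Num.Theory GroupScope.
Local Open Scope ring_scope.

(** * Quadratic Boolean functions on a commutative finite group: bias and periods *)

Section QuadraticBits.

Variables (R : rcfType) (gT : finGroupType).
Hypothesis mulgCT : commutative (@mulg gT).
Implicit Types (q : gT -> bool) (x y u v : gT) (H : {group gT}).

(** Degree at most 2 without coordinates: second differences do not depend on the base point. *)
Definition quadratic q := forall x y u v,
  q x (+) q (x * u)%g (+) q (x * v)%g (+) q (x * u * v)%g =
  q y (+) q (y * u)%g (+) q (y * v)%g (+) q (y * u * v)%g.

Lemma quadratic_addb q1 q2 :
  quadratic q1 -> quadratic q2 -> quadratic (fun x => q1 x (+) q2 x).
Proof.
have eAC (a a' b b' c c' d d' : bool) : a (+) a' (+) (b (+) b') (+) (c (+) c')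
    (+) (d (+) d') = (a (+) b (+) c (+) d) (+) (a' (+) b' (+) c' (+) d').
  by move: a a' b b' c c' d d'; do 8!case.
by move=> h1 h2 x y u v; rewrite !eAC (h1 x y u v) (h2 x y u v).
Qed.

Lemma quadratic_cst b : quadratic (fun=> b).
Proof. by case: b. Qed.

Lemma quadratic_translate q c : quadratic q -> quadratic (fun x => q (x * c)%g).
Proof.
move=> hq x y u v; have := hq (x * c)%g (y * c)%g u v.
have e z w : (z * c * w = z * w * c)%g by rewrite -!mulgA (mulgCT c).
by rewrite !e.
Qed.

Lemma quadratic_sum (I : finType) (A : {set I}) (q : I -> gT -> bool) :
  (forall i, quadratic (q i)) ->
  quadratic (fun x => \big[addb/false]_(i in A) q i x).
Proof.
move=> hq x y u v; rewrite -!big_split /=; apply: eq_bigr => i _; exact: hq.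
Qed.

Definition bias H q : R := \sum_(x in H) (-1) ^+ q x.

Definition periods H q := [set u in H | [forall x in H, q (x * u)%g == q x]].

Lemma periods_group_set H q : group_set (periods H q).
Proof.
apply/group_setP; split.
  by rewrite inE group1; apply/forall_inP => x _; rewrite mulg1.
move=> u v; rewrite !inE => /andP[uH /forall_inP hu] /andP[vH /forall_inP hv].
rewrite groupM //; apply/forall_inP => x xH.
by rewrite mulgA (eqP (hv _ _)) ?groupM // hu.
Qed.

Canonical periods_group H q := Group (periods_group_set H q).

Lemma periods_sub H q : periods H q \subset H.
Proof. by apply/subsetP => u; rewrite inE => /andP[]. Qed.

Lemma big_translate H u (F : gT -> R) : u \in H ->
  \sum_(x in H) F (x * u)%g = \sum_(x in H) F x.
Proof.
move=> uH; rewrite [RHS](reindex_inj (mulIg u)) /=.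
by apply: eq_bigl => x; rewrite groupMr.
Qed.

(** Expanding the square gives, for each direction [u], the signed sum of the derivative of [q]
    along [u]. That derivative is affine, so its signed sum vanishes unless it is constant; the
    periods contribute [#|H|] each. *)
Lemma bias_sqr H q : quadratic q -> bias H q != 0 ->
  bias H q ^+ 2 = #|H|%:R * #|periods H q|%:R.
Proof.
move=> hq b0.
have -> : bias H q ^+ 2 =
    \sum_(u in H) \sum_(x in H) (-1) ^+ (q x (+) q (x * u)%g).
  rewrite exchange_big expr2 mulr_suml; apply: eq_bigr => x xH.
  rewrite mulr_sumr [LHS](reindex_inj (mulgI x)) /=.
  rewrite (eq_bigl (fun u => u \in H)); last by move=> u; rewrite groupMl.
  by apply: eq_bigr => u uH; rewrite signr_addb.
rewrite (bigID (fun u => u \in periods H q)) /=.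
rewrite [X in _ + X]big1 ?addr0; last first.
  (* A non-constant derivative is negated by some shift [v], so its signed sum equals its own
     opposite. *)
  move=> u /andP[uH uP].
  have [/exists_inP[v vH vP]|] := boolP
    [exists v in H, q v (+) q (v * u)%g != q 1%g (+) q (1 * u)%g].
    set S := \sum_(x in H) _; suff : S = - S by lra.
    rewrite {1}/S -(big_translate _ vH) -sumrN; apply: eq_bigr => x _.
    suff -> : q (x * v)%g (+) q (x * v * u)%g = ~~ (q x (+) q (x * u)%g).
      by rewrite signrN.
    have := hq x 1%g v u; move: vP; rewrite !mul1g.
    have -> : (x * v * u = x * u * v)%g by rewrite -!mulgA (mulgCT u).
    by do 8!case: (q _).
  rewrite negb_exists_in => /forall_inP hc.
  (* A constant derivative equal to [false] would make [u] a period; equal to [true], it makes the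
     shift by [u] negate the bias, against [b0]. *)
  case E : (q 1%g (+) q (1 * u)%g); last first.
    case/negP: uP; rewrite inE uH; apply/forall_inP => x xH.
    by have := hc x xH; rewrite negbK E; do 2!case: (q _).
  suff : bias H q = - bias H q by move=> ?; case/eqP: b0; lra.
  rewrite {1}/bias -(big_translate _ uH) -sumrN; apply: eq_bigr => x xH.
  by have := hc x xH; rewrite negbK E; do 2!case: (q _) => //=; rewrite ?expr0 ?expr1 ?opprK.
rewrite (eq_bigl (fun u => u \in periods H q)); last first.
  by move=> u; rewrite inE; case: (u \in H).
rewrite (eq_bigr (fun=> #|H|%:R)) ?sumr_const ?mulr_natr // => u.
rewrite inE => /andP[uH /forall_inP hu].
rewrite (eq_bigr (fun=> 1)) ?sumr_const // => x xH.
by rewrite (eqP (hu x xH)) addbb.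
Qed.

End QuadraticBits.

(** * Hellinger affinity of one quadratic bit with a Bernoulli(1/3) bit *)

Section Probability.

Variables (R : rcfType) (gT : finGroupType).
Hypothesis mulgCT : commutative (@mulg gT).
Variable m : nat.
Hypothesis card_gT : #|gT| = (2 ^ m)%N.
Implicit Types (q : gT -> bool) (H : {group gT}).

Definition ber (b : bool) : R := if b then 1 / 3 else 2 / 3.

(** A gap of 1/100 between [p] and 1/3 costs [(1 / 100) ^+ 2 / 8] for each of the two values of the
    bit. *)
Definition rho : R := 1 - (1 / 200) ^+ 2.

(** With [a], [b] the square roots, the AM-GM deficit is [(a - b) ^+ 2 / 2], while [(p - r) ^+ 2 =
    (a - b) ^+ 2 * (a + b) ^+ 2] and [a + b <= 2]. *)
Lemma sqrt_prod_le (p r : R) : 0 <= p <= 1 -> 0 <= r <= 1 ->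
  Num.sqrt (p * r) <= (p + r) / 2 - (p - r) ^+ 2 / 8.
Proof.
move=> /andP[p0 p1] /andP[r0 r1]; rewrite sqrtrM //.
have := sqr_sqrtr p0; have := sqr_sqrtr r0.
have := sqrtr_ge0 p; have := sqrtr_ge0 r.
set a := Num.sqrt p; set b := Num.sqrt r => b0 a0 eb ea.
have a1 : a <= 1 by nra.
have b1 : b <= 1 by nra.
rewrite -ea -eb.
have : (a - b) ^+ 2 * (4 - (a + b) ^+ 2) >= 0.
  by rewrite mulr_ge0 ?sqr_ge0 //; nra.
lra.
Qed.

(* The squared bias [(1 - 2 p) ^+ 2] avoids 1/9, so [p] stays away from 1/3. *)
Lemma affinity_le (p : R) (r : nat) : 0 <= p <= 1 ->
  (1 - 2 * p) ^+ 2 = 0 \/ (1 - 2 * p) ^+ 2 = 2 ^- r ->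
  Num.sqrt (p * (1 / 3)) + Num.sqrt ((1 - p) * (2 / 3)) <= rho.
Proof.
move=> p01 hp.
have h1 := @sqrt_prod_le p (1 / 3) p01 ltac:(lra).
have h2 := @sqrt_prod_le (1 - p) (2 / 3) ltac:(lra) ltac:(lra).
suff : (p - 1 / 3) ^+ 2 >= (1 / 100) ^+ 2 by rewrite /rho; lra.
(* No power of 2 lies strictly between 1/16 and 1/8, whereas [p] within 1/100 of 1/3 would put the
   squared bias there. *)
have gap : (1 - 2 * p) ^+ 2 <= 1 / 16 \/ (1 - 2 * p) ^+ 2 >= 1 / 8.
  case: hp => ->; first by left; lra.
  have [r3|r4] := leqP r 3.
    right; rewrite (_ : 1 / 8 = 2 ^- 3); last by rewrite div1r; congr _^-1; lra.
    by rewrite lef_pV2 ?posrE ?exprn_gt0 // ler_eXn2l // ltr1n.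
  left; rewrite (_ : 1 / 16 = 2 ^- 4); last by rewrite div1r; congr _^-1; lra.
  by rewrite lef_pV2 ?posrE ?exprn_gt0 // ler_eXn2l // ltr1n.
rewrite leNgt; apply/negP => hlt.
have hl : - (1 / 100) < p - 1 / 3 by nra.
have hu : p - 1 / 3 < 1 / 100 by nra.
by case: gap; nra.
Qed.

Definition prob H q (b : bool) : R :=
  (\sum_(x in H) (q x == b)%:R) / #|H|%:R.

Lemma prob_ge0 H q b : 0 <= prob H q b.
Proof. by rewrite divr_ge0 ?ler0n ?sumr_ge0. Qed.

Lemma cardG_neq0 H : #|H|%:R != 0 :> R.
Proof. by rewrite pnatr_eq0 -lt0n cardG_gt0. Qed.

Lemma prob_false H q : prob H q false = 1 - prob H q true.
Proof.
have h0 := cardG_neq0 H.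
apply/(mulIf h0); rewrite mulrBl mul1r !divfK // -sumr_const -sumrB.
by apply: eq_bigr => x _; case: (q x); rewrite /= ?subrr ?subr0.
Qed.

Lemma prob_bias H q : 1 - 2 * prob H q true = bias R H q / #|H|%:R.
Proof.
have h0 := cardG_neq0 H.
apply/(mulIf h0); rewrite mulrBl mul1r -mulrA !divfK // mulr_sumr -sumr_const.
rewrite -sumrB; apply: eq_bigr => x _.
by case: (q x); rewrite /= ?expr0 ?expr1; lra.
Qed.

(** By [bias_sqr] a nonzero squared relative bias is [#|periods H q| / #|H|], a ratio of two powers
    of 2 by Lagrange. *)
Lemma quadratic_affinity H q : quadratic q ->
  \sum_b Num.sqrt (prob H q b * ber b) <= rho.
Proof.
move=> hq; rewrite big_bool /= prob_false /ber.
have h0 := cardG_neq0 H.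
have hp : 0 <= prob H q true <= 1.
  by rewrite prob_ge0 /= -subr_ge0 -prob_false prob_ge0.
have [b0|b0] := eqVneq (bias R H q) 0.
  by apply: (@affinity_le _ 0 hp); left; rewrite prob_bias b0 mul0r expr0n /=.
have card2 (L : {group gT}) : exists2 a, (a <= m)%N & #|L| = (2 ^ a)%N.
  apply/dvdn_pfactor => //; rewrite -card_gT -cardsT.
  by rewrite (cardSg (subsetT L)).
have [a am ea] := card2 H.
have /dvdn_pfactor [//|c ca ec] : (#|periods_group H q| %| 2 ^ a)%N.
  by rewrite -ea cardSg ?periods_sub.
apply: (@affinity_le _ (a - c) hp); right.
rewrite prob_bias expr_div_n bias_sqr // expr2 -mulf_div divff // mul1r.
rewrite ec ea !natrX; apply: (mulIf (_ : 2 ^+ a != 0)).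
  by rewrite expf_neq0 ?pnatr_eq0.
rewrite divfK ?expf_neq0 ?pnatr_eq0 //.
by rewrite -{2}(subnK ca) exprD mulKf ?expf_neq0 ?pnatr_eq0.
Qed.

End Probability.

(** * Independent families of bits on a subgroup *)

Section Independence.

Variables (R : rcfType) (gT : finGroupType) (I : finType).
Hypothesis mulgCT : commutative (@mulg gT).
Variable K : I -> {group gT}.
Implicit Types (H : {group gT}) (s : seq I) (z : I -> bool).

(** Averaging over translations by [H1] leaves [F] unchanged and turns [g] into a constant on [H],
    because [H1] reaches every class of [H] modulo [L]. Hence [F] and [g] are uncorrelated on
    [H]. *)
Lemma sum_mul_indep (H H1 L : {group gT}) (F g : gT -> R) :
  H1 \subset H -> H \subset (H1 * L)%g ->
  (forall x u, u \in H1 -> F (x * u)%g = F x) ->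
  (forall x u, u \in L -> g (x * u)%g = g x) ->
  #|H|%:R * \sum_(x in H) (F x * g x) =
  (\sum_(x in H) F x) * (\sum_(x in H) g x).
Proof.
move=> sH1 sH hF hg.
pose C := \sum_(h in H1) g h.
have gC x : x \in H -> \sum_(h in H1) g (x * h)%g = C.
  move=> /(subsetP sH) /mulsgP[h' k h'H kL ->].
  rewrite /C -[RHS](big_translate _ h'H); apply: eq_bigr => h _.
  by rewrite -mulgA (mulgCT k) mulgA (hg _ _ kL) (mulgCT h).
have avg (E : gT -> R) :
    #|H1|%:R * \sum_(x in H) E x = \sum_(x in H) \sum_(h in H1) E (x * h)%g.
  rewrite exchange_big /= mulr_natl -sumr_const; apply: eq_bigr => h hH1.
  by rewrite (big_translate _ (subsetP sH1 _ hH1)).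
have e1 : #|H1|%:R * \sum_(x in H) g x = #|H|%:R * C.
  by rewrite avg mulr_natl -sumr_const; apply: eq_bigr.
have e2 : #|H1|%:R * \sum_(x in H) (F x * g x) = (\sum_(x in H) F x) * C.
  rewrite avg mulr_suml; apply: eq_bigr => x xH.
  by rewrite -(gC x xH) mulr_sumr; apply: eq_bigr => h hH1; rewrite hF.
apply: (mulfI (cardG_neq0 R H1)).
by rewrite mulrCA e2 mulrCA -[RHS]mulrCA e1 mulrCA.
Qed.

Definition core H s : {group gT} := foldr (fun j G => (G :&: K j)%G) H s.

Lemma core_sub H s : core H s \subset H.
Proof. by elim: s => //= j s; apply: subset_trans; apply: subsetIl. Qed.

Lemma core_subK H s j : j \in s -> core H s \subset K j.
Proof.
elim: s => //= i s IH; rewrite inE => /predU1P[->|/IH].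
  exact: subsetIr.
by apply: subset_trans; apply: subsetIl.
Qed.

(* Modulo [H], the dual spaces of the subgroups [K j], [j] in [s], are
   independent. *)
Fixpoint indep H s : bool :=
  if s is j :: s' then (H \subset core H s' * K j)%g && indep H s' else true.

Lemma indep_prod H s z (f : I -> gT -> bool) : indep H s ->
  (forall j, j \in s -> forall x u, u \in K j -> f j (x * u)%g = f j x) ->
  (\sum_(x in H) \prod_(j <- s) (f j x == z j)%:R) / #|H|%:R =
  \prod_(j <- s) prob R H (f j) (z j).
Proof.
have h0 := cardG_neq0 R H.
elim: s => [_ _|j s IH /= /andP[sH /IH{}IH] hf].
  rewrite big_nil (eq_bigr (fun=> 1)) ?sumr_const ?divff // => x _.
  by rewrite big_nil.
rewrite [X in X / _](eq_bigr (fun x =>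
  (\prod_(i <- s) (f i x == z i)%:R) * (f j x == z j)%:R)); last first.
  by move=> x _; rewrite big_cons mulrC.
rewrite big_cons -IH; last by move=> i js; apply: hf; rewrite inE js orbT.
apply: (mulfI h0); apply: (mulIf h0); rewrite mulrA divfK //.
rewrite (sum_mul_indep (core_sub H s) sH); last first.
- by move=> x u uK; rewrite hf ?mem_head.
- move=> x u uC; apply: eq_big_seq => i js; rewrite hf ?inE ?js ?orbT //.
  exact: subsetP (core_subK H js) _ uC.
rewrite /prob; set a := \sum_(x in H) _; set b := \sum_(x in H) _.
by field.
Qed.

(** The family grows one index at a time until it has length [t] or nothing in [A] extends it. *)
Lemma greedy H (A : {set I}) t : exists s,
  [/\ uniq s, {subset s <= A}, indep H s &
    size s = t \/ (size s < t)%N /\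
      forall j, j \in A -> j \notin s -> ~~ (H \subset core H s * K j)%g].
Proof.
elim: t => [|t [s [us sA ds [ss|[ss hs]]]]].
- by exists [::]; split => //; left.
- have [/exists_inP[j jA /andP[js hj]]|hN] := boolP
    [exists j in A, (j \notin s) && (H \subset core H s * K j)%g].
    exists (j :: s); split => /=; rewrite ?js ?hj //; last by left; rewrite ss.
    by move=> i; rewrite inE => /predU1P[->|/sA].
  exists s; split => //; right; rewrite ss; split => // j jA js.
  move: hN; rewrite negb_exists_in => /forall_inP /(_ j jA).
  by rewrite js.
- by exists s; split => //; right; split => //; apply: ltnW.
Qed.

Lemma card_core H D s :
  (forall j, j \in s -> #|gT| <= #|K j| * D)%N ->
  (#|H| <= #|core H s| * D ^ size s)%N.
Proof.
elim: s => [|j s IH] hK /=; first by rewrite muln1.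
apply: (leq_trans (IH _)); first by move=> i js; apply: hK; rewrite inE js orbT.
rewrite expnS mulnA leq_mul2r; apply/orP; right.
rewrite -(leq_pmul2r (cardG_gt0 (K j))) mul_cardG mulnC -mulnA leq_mul2l.
rewrite (mulnC D) (leq_trans (max_card _)) ?orbT // hK ?mem_head //.
Qed.

Lemma card_proper_subgroup (H L : {group gT}) : H \proper L -> (#|H| * 2 <= #|L|)%N.
Proof.
move=> hHL; have := cardSg (proper_sub hHL); have := proper_card hHL.
move=> lt /dvdnP[k e]; rewrite e in lt *; rewrite mulnC leq_mul2r.
by case: k lt {e} => [|[|k]]; rewrite ?mul0n ?mul1n ?ltnn ?orbT.
Qed.

(** The product of [H1] and [H :&: L] is a proper subgroup of [H], so its index is at least 2; and
    the index of [H1 :&: L] in [H1] equals that of [H :&: L] in this product. *)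
Lemma card_drop (H H1 L : {group gT}) i : H1 \subset H ->
  ~~ (H \subset H1 * L)%g ->
  (#|H| <= #|H :&: L| * 2 ^ i.+1 -> #|H1| <= #|H1 :&: L| * 2 ^ i)%N.
Proof.
move=> sH nH hi.
have cHL : commute H1 (H :&: L)%G.
  by apply/setP => x; apply/mulsgP/mulsgP => -[a b aH bH ->]; exists b a.
have pr : (H1 <*> (H :&: L)%G)%G \proper H.
  rewrite properE join_subG sH subsetIl /= comm_joingE //.
  apply: contra nH => /subset_trans; apply.
  by apply: mulgS; apply: subsetIr.
have := card_proper_subgroup pr; rewrite /= comm_joingE // => h2.
have e := mul_cardG H1 (H :&: L).
have eI : H1 :&: (H :&: L) = H1 :&: L by rewrite setIA (setIidPl sH).
rewrite /= eI in e.
rewrite -(leq_pmul2r (cardG_gt0 (H :&: L))) e.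
rewrite -(leq_pmul2r (isT : 0 < 2)%N) mulnAC.
apply: (leq_trans (leq_mul h2 (leqnn _))).
apply: (leq_trans (leq_mul hi (leqnn _))).
by rewrite expnS /=; move: (2 ^ i)%N #|_ :&: _| #|_ :&: _| => a c e'; nia.
Qed.

(* Each failure of the greedy choice costs a factor [(1 + d * M)] in the
   exponent of the index of [H], and lowers the codimension of every [K j]
   inside [H]; [b] is the price already paid. *)
Lemma independent_family (A : {set I}) (d M b i : nat) H w :
  (forall j, j \in A -> #|gT| <= #|K j| * 2 ^ d)%N ->
  (#|gT| <= #|H| * 2 ^ w)%N ->
  (forall j, j \in A -> #|H| <= #|H :&: K j| * 2 ^ i)%N ->
  (M * ((1 + d * M) ^ i * (w + b)) <= #|A|)%N ->
  exists (L : {group gT}) s v,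
    [/\ uniq s, {subset s <= A}, indep L s, (#|gT| <= #|L| * 2 ^ v)%N &
        size s = M * (v + b)]%N.
Proof.
move=> hK; elim: i H w => [|i IH] H w hw hi hA.
  have [s [us sA ds [ss|[ss hs]]]] := greedy H A (M * (w + b)).
    by exists H, s, w.
  suff : (#|A| <= size s)%N by lia.
  rewrite -(card_uniqP us); apply/subset_leq_card/subsetP => j jA.
  apply: contraT => js; have := hs j jA js.
  have : H \subset K j.
    have := hi j jA; rewrite muln1 => hc; apply/setIidPl/eqP.
    by rewrite eqEcard subsetIl.
  move=> /subset_trans -> //; exact: mulG_subr.
have [s [us sA ds [ss|[ss hs]]]] := greedy H A (M * (w + b)).
  by exists H, s, w.
(* Fewer than [M * (w + b)] intersections, each of codimension at most [d], multiply [w + b] by at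
   most [1 + d * M]. *)
apply: (IH (core H s) (w + d * (M * (w + b)))%N).
- apply: (leq_trans hw).
  have := @card_core H (2 ^ d) s (fun j js => hK j (sA j js)).
  rewrite -expnM => hc; rewrite addnC expnD mulnA leq_mul2r; apply/orP; right.
  apply: (leq_trans hc); rewrite leq_mul2l; apply/orP; right.
  by rewrite leq_exp2l // leq_mul2l (ltnW ss) orbT.
- move=> j jA; have [js|js] := boolP (j \in s).
    by rewrite (setIidPl (core_subK H js)) leq_pmulr ?expn_gt0.
  exact: (card_drop (core_sub H s) (hs j jA js) (hi j jA)).
- by move: hA; rewrite expnSr -[(_ ^ i * _ * _)%N]mulnA; congr (_ * (_ * _) <= _)%N; lia.
Qed.

End Independence.

(** * Overlap of the joint law with the Bernoulli product *)

Section Affinity.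

Variables (R : rcfType) (gT : finGroupType) (I : finType).
Hypothesis mulgCT : commutative (@mulg gT).
Variable m : nat.
Hypothesis card_gT : #|gT| = (2 ^ m)%N.
Variable q : I -> gT -> bool.
Hypothesis hq : forall i, quadratic (q i).
Implicit Types (y z : {ffun I -> bool}) (J S T : {set I}).

Definition law y : R := (\sum_x ([ffun i => q i x] == y)%:R) / #|gT|%:R.

Definition ber_law y : R := \prod_i ber R (y i).

(** This is one minus the total variation distance of the two laws. *)
Definition overlap : R := \sum_y Num.min (law y) (ber_law y).

(** Outcomes on [J] are encoded as functions on all of [I] that are [false] off [J], which matches
    [pffun_on]. *)
Definition restr J y : {ffun I -> bool} := [ffun i => (i \in J) && y i].

Lemma ber_ge0 b : 0 <= ber R b.
Proof. by case: b; rewrite divr_ge0. Qed.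

Lemma min_le_sqrt (a b : R) : 0 <= a -> 0 <= b -> Num.min a b <= Num.sqrt (a * b).
Proof.
move=> a0 b0; have m0 : 0 <= Num.min a b by rewrite le_min a0.
rewrite -{1}(ger0_norm m0) -sqrtr_sqr ler_sqrt ?mulr_ge0 //.
by rewrite expr2 ler_pM // ge_min lexx ?orbT.
Qed.

(** Truncation at [d] is subadditive on nonnegative reals, so the bound by the geometric mean
    applies termwise. *)
Lemma min_sum_le (C : finType) (A : {set C}) (a : C -> R) (d : R) :
  (forall c, 0 <= a c) -> 0 <= d ->
  Num.min (\sum_(c in A) a c) d <= \sum_(c in A) Num.sqrt (a c * d).
Proof.
move=> a0 d0.
pose P (u v : R) := 0 <= u /\ Num.min u d <= v.
suff [] : P (\sum_(c in A) a c) (\sum_(c in A) Num.sqrt (a c * d)) by [].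
apply: (big_ind2 P).
- by split => //; rewrite ge_min lexx.
- move=> u v u' v' [u0 hv] [u'0 hv']; split; first exact: addr_ge0.
  by move: hv hv'; rewrite !minEle; do 3!case: ifP; lra.
- by move=> c _; split => //; apply: min_le_sqrt.
Qed.

Lemma sqrt_prod (A : {set I}) (F : I -> R) : (forall i, 0 <= F i) ->
  Num.sqrt (\prod_(i in A) F i) = \prod_(i in A) Num.sqrt (F i).
Proof.
move=> F0; pose P (u v : R) := 0 <= u /\ Num.sqrt u = v.
suff [] : P (\prod_(i in A) F i) (\prod_(i in A) Num.sqrt (F i)) by [].
apply: (big_ind2 P) => [|u v u' v' [u0 <-] [u'0 <-]|//].
  by rewrite /P sqrtr1.
by split; rewrite ?mulr_ge0 ?sqrtrM.
Qed.

Lemma ber_law_restr J z : z \in pffun_on false (mem J) predT ->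
  \sum_(y | restr J y == z) ber_law y = \prod_(j in J) ber R (z j).
Proof.
move=> /pffun_onP[/subsetP supz _].
pose Q i b := (i \in J) ==> (b == z i).
rewrite big_mkcond /= [RHS]big_mkcond /=.
transitivity (\prod_i \sum_(b | Q i b) ber R b); last first.
  apply: eq_bigr => i _; rewrite /Q; case: (i \in J) => /=.
    by rewrite big_pred1_eq.
  by rewrite big_bool /= /ber; lra.
rewrite bigA_distr_big_dep -big_mkcond /=; apply: eq_bigl => y.
apply/eqP/familyP => [e i|hy].
  by rewrite unfold_in /Q -e ffunE; case: (i \in J) => /=.
apply/ffunP => i; rewrite ffunE; have := hy i; rewrite unfold_in /Q.
case: (boolP (i \in J)) => iJ /= => [/eqP //|_].
by apply/esym/negbTE; apply: contraNN iJ => zi; apply: supz; rewrite unfold_in eqbF_neg negbK.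
Qed.

(** Passing to the marginals on [J] can only increase the overlap. There the law is dominated by a
    sum of [#|A|] product weights, the minimum splits over them, and each affinity factors over
    [J]. *)
Lemma overlap_le (C : finType) (A : {set C}) J (g : C -> I -> bool -> R) :
  (forall c i b, 0 <= g c i b) ->
  (forall z, (\sum_x \prod_(j in J) (q j x == z j)%:R) / #|gT|%:R <=
     \sum_(c in A) \prod_(j in J) g c j (z j)) ->
  (forall c j, c \in A -> j \in J -> \sum_b Num.sqrt (g c j b * ber R b) <= rho R) ->
  overlap <= #|A|%:R * rho R ^+ #|J|.
Proof.
move=> g0 hP hrho.
have ber0 (E : pred I) y : 0 <= \prod_(i | E i) ber R (y i).
  by apply: prodr_ge0 => i _; apply: ber_ge0.
rewrite /overlap (partition_big (restr J) (fun z => z \in pffun_on false (mem J) predT)) /=; last first.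
  move=> y _; apply/pffun_onP; split => //.
  by apply/subsetP => i; rewrite unfold_in ffunE; case: (i \in J).
apply: (@le_trans _ _ (\sum_(z in pffun_on false (mem J) predT)
   \sum_(c in A) Num.sqrt (\prod_(j in J) g c j (z j) * \prod_(j in J) ber R (z j)))).
  apply: ler_sum => z hz; rewrite -(ber_law_restr hz).
  apply: le_trans (min_sum_le _ _ _); last 2 first.
  - by move=> c; apply: prodr_ge0.
  - by apply: sumr_ge0 => y _; apply: ber0.
  rewrite le_min; apply/andP; split; last first.
    by apply: ler_sum => y _; rewrite ge_min lexx orbT.
  apply: le_trans (hP z); apply: (@le_trans _ _ (\sum_(y | restr J y == z) law y)).
    by apply: ler_sum => y _; rewrite ge_min lexx.
  rewrite /law -mulr_suml ler_wpM2r ?invr_ge0 // exchange_big /=.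
  apply: ler_sum => x _.
  rewrite big_mkcond /= (bigD1 [ffun i => q i x]) //= eqxx.
  rewrite big1 ?addr0; last first.
    by move=> y; rewrite eq_sym => /negbTE ->; case: ifP.
  case: eqP => [<-|_]; last by apply: prodr_ge0.
  by rewrite big1 // => j jJ; rewrite !ffunE jJ /= eqxx.
rewrite exchange_big /= mulr_natl -sumr_const; apply: ler_sum => c cA.
rewrite (eq_bigr (fun z : {ffun I -> bool} =>
    \prod_(j in J) Num.sqrt (g c j (z j) * ber R (z j)))); last first.
  move=> z _; rewrite -big_split /=.
  by rewrite sqrt_prod // => i; rewrite mulr_ge0 ?ber_ge0.
rewrite -(big_distr_big false (mem J) predT (fun j b => Num.sqrt (g c j b * ber R b))).
rewrite -prodr_const; apply: ler_prod => j jJ.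
by rewrite hrho // andbT sumr_ge0 // => b _; apply: sqrtr_ge0.
Qed.

End Affinity.

(** * The dichotomy between an unbiased family and low rank modulo few bits *)

Section Dichotomy.

Variables (R : rcfType) (gT : finGroupType) (I : finType).
Hypothesis mulgCT : commutative (@mulg gT).
Variable m : nat.
Hypothesis card_gT : #|gT| = (2 ^ m)%N.
Variable q : I -> gT -> bool.
Hypothesis hq : forall i, quadratic (q i).
Implicit Types (y z : {ffun I -> bool}) (J S T : {set I}).

Definition subset_sum S x : bool := \big[addb/false]_(i in S) q i x.

Definition small_bias (K : nat) S : bool :=
  `|bias R [set: gT] (subset_sum S)| * 2 ^+ K <= #|gT|%:R.

Definition unbiased K J : bool :=
  [forall S : {set I}, (S \subset J) && (S != set0) ==> small_bias K S].

Lemma signr_sum (A : {set I}) (F : I -> bool) :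
  (-1) ^+ (\big[addb/false]_(i in A) F i) = \prod_(i in A) (-1) ^+ F i :> R.
Proof. by apply: (big_morph (fun b : bool => (-1) ^+ b)) => // a b; rewrite signr_addb. Qed.

(** Fourier inversion: the empty subset contributes the uniform weight, and the fewer than [2 ^ K]
    other subsets, each of relative bias at most [2 ^- K], contribute at most as much again. *)
Lemma unbiased_law_le K J z : unbiased K J -> #|J| = K ->
  (\sum_x \prod_(j in J) (q j x == z j)%:R) / #|gT|%:R
    <= 2 * \prod_(j in J) (1 / 2) :> R.
Proof.
move=> hJ cJ.
have G0 : 0 < #|gT|%:R :> R by rewrite card_gT ltr0n expn_gt0.
rewrite ler_pdivrMr // prodr_const cJ.
pose Fz (f : {ffun I -> bool}) := [set i in J | f i].
pose sgz (f : {ffun I -> bool}) : R := \prod_(i in Fz f) (-1) ^+ z i.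
(* Each indicator is half of one plus a product of signs; [f] records which factors take the
   sign. *)
have expand x : \prod_(j in J) (q j x == z j)%:R =
    \sum_(f in pffun_on false (mem J) predT)
       (1 / 2) ^+ K * (sgz f * (-1) ^+ subset_sum (Fz f) x) :> R.
  transitivity (\prod_(j in J) \sum_(b : bool)
      (1 / 2 * (if b then (-1) ^+ z j * (-1) ^+ q j x else 1)) : R).
    apply: eq_bigr => j _; rewrite big_bool /=.
    by case: (q j x); case: (z j) => /=; rewrite ?expr0 ?expr1; lra.
  rewrite (big_distr_big false (mem J) predT (fun j b =>
     1 / 2 * (if b then (-1) ^+ z j * (-1) ^+ q j x else 1))).
  apply: eq_bigr => f _; rewrite big_split /= prodr_const cJ; congr (_ * _).
  rewrite /sgz /subset_sum signr_sum -big_split /= -big_mkcondr /=.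
  by apply: eq_bigl => i; rewrite inE.
rewrite (eq_bigr _ (fun x _ => expand x)) exchange_big /=.
under eq_bigr do rewrite -!mulr_sumr.
rewrite -mulr_sumr -mulrA mulrCA ler_wpM2l ?exprn_ge0 ?divr_ge0 //.
have hsg f : `|sgz f| = 1 by rewrite /sgz normr_prod big1 // => i _; rewrite normr_sign.
have biasE S : \sum_x (-1) ^+ subset_sum S x = bias R [set: gT] (subset_sum S).
  by apply: eq_bigl => x; rewrite inE.
pose f0 : {ffun I -> bool} := [ffun=> false].
have f0P : f0 \in pffun_on false (mem J) predT.
  by apply/pffun_onP; split => //; apply/subsetP => i; rewrite unfold_in ffunE.
rewrite (bigD1 f0) //= mulr_natl mulr2n; apply: lerD.
  rewrite (le_trans (ler_norm _)) // normrM hsg mul1r.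
  apply: (le_trans (ler_norm_sum _ _ _)).
  by under eq_bigr do rewrite normr_sign; rewrite sumr_const.
have cf : #|(pffun_on false (mem J) predT : pred {ffun I -> bool})| = (2 ^ K)%N.
  by rewrite card_pffun_on cJ card_bool.
apply: (@le_trans _ _ (\sum_(f in pffun_on false (mem J) predT) #|gT|%:R / 2 ^+ K)).
  rewrite [leRHS](bigD1 f0) //= ler_wpDl ?divr_ge0 ?exprn_ge0 //.
  apply: ler_sum => f /andP[/pffun_onP[/subsetP fJ _] f0n].
  rewrite (le_trans (ler_norm _)) // normrM hsg mul1r biasE.
  rewrite ler_pdivlMr ?exprn_gt0 //.
  have := forallP hJ (Fz f); rewrite -[_ && _]/(_ && _) => /implyP; apply.
  apply/andP; split; first by apply/subsetP => i; rewrite inE => /andP[].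
  apply: contra f0n => /eqP /setP e; apply/eqP/ffunP => i; rewrite ffunE.
  have := e i; rewrite !inE; case fi : (f i) => //.
  by rewrite fJ // unfold_in fi.
by rewrite sumr_const cf -[leLHS]mulr_natr natrX divfK // expf_neq0 // pnatr_eq0.
Qed.

(** Take [J] of maximal size. If it is smaller than [K], adding [j] creates a biased subset, which
    must contain [j]. *)
Lemma maximal_unbiased K : exists J,
  [/\ unbiased K J, (#|J| <= K)%N &
   #|J| = K \/ forall j, j \notin J -> exists2 S : {set I}, S \subset J &
     ~~ small_bias K (j |: S)].
Proof.
have g0 : unbiased K set0 && (#|(set0 : {set I})| <= K)%N.
  rewrite cards0 andbT; apply/forallP => S; apply/implyP.
  by rewrite subset0 => /andP[/eqP ->]; rewrite eqxx.
case: (@arg_maxnP _ set0 (fun J => unbiased K J && (#|J| <= K)%N) (fun J => #|J|) g0).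
move=> J /andP[hJ cJ] mx; exists J; split => //.
move: (cJ); rewrite leq_eqVlt => /predU1P[->|ltK]; [by left | right => j jJ].
have : ~~ unbiased K (j |: J).
  apply/negP => h; have := mx (j |: J); rewrite h cardsU1 jJ /= => /(_ ltK).
  by rewrite add1n /= ltnn.
rewrite negb_forall => /existsP[S]; rewrite negb_imply => /andP[/andP[sS S0] nS].
have jS : j \in S.
  apply: contraNT nS => jS; have := forallP hJ S; rewrite S0 andbT => /implyP; apply.
  apply/subsetP => i iS; have := subsetP sS i iS; rewrite !inE => /predU1P[e|//].
  by rewrite -e iS in jS.
exists (S :\ j); last by rewrite setD1K.
by rewrite subDset.
Qed.

Lemma periods_of_large_bias K S : ~~ small_bias K S ->
  (#|gT| <= #|periods [set: gT] (subset_sum S)| * 2 ^ (2 * K))%N.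
Proof.
rewrite /small_bias -ltNge => hb.
have G0 : 0 < #|gT|%:R :> R by rewrite card_gT ltr0n expn_gt0.
have b0 : bias R [set: gT] (subset_sum S) != 0.
  by apply: contraTneq hb => ->; rewrite normr0 mul0r -leNgt ltW.
have := bias_sqr mulgCT (quadratic_sum S hq) b0.
rewrite cardsT => eb.
rewrite -(ler_nat R) natrM natrX -(ler_pM2l G0) mulrA -eb.
rewrite mulnC exprM -exprMn -expr2 -real_normK ?num_real // -[leRHS]real_normK ?num_real //.
by rewrite ler_sqr ?nnegrE // normrM (ger0_norm (exprn_ge0 _ _)) // ger0_norm ?ltW.
Qed.

Lemma overlap_unbiased K J : unbiased K J -> #|J| = K ->
  overlap R q <= 2 * rho R ^+ K.
Proof.
move=> hJ cJ.
(* The factor 2 is realised as two copies of the uniform law, indexed by [bool]. *)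
have := @overlap_le R gT I q bool [set: bool] J (fun _ _ _ => 1 / 2) _ _ _.
rewrite cardsT card_bool cJ; apply => [_ _ _|z|c j _ _].
- by rewrite divr_ge0.
- by rewrite sumr_const cardsT card_bool -[leRHS]mulr_natl (unbiased_law_le _ hJ cJ).
- have h : 1 - 2 * (1 / 2) = 0 :> R by lra.
  rewrite big_bool /=.
  have /= := @affinity_le R (1 / 2) 0; rewrite h expr0n /=.
  have -> : 1 - 1 / 2 = 1 / 2 :> R by lra.
  by apply; [lra | left].
Qed.

Lemma rho_ge0 : 0 <= rho R.
Proof. rewrite /rho; lra. Qed.

Lemma prob_addb (H : {group gT}) (f : gT -> bool) b c :
  prob R H f (b (+) c) = prob R H (fun x => f x (+) c) b.
Proof.
by congr (_ / _); apply: eq_bigr => x _; congr _%:R; case: (f x); case: b; case: c.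
Qed.

Lemma overlap_low_rank K J M : (0 < M)%N -> rho R ^+ M <= 1 / 4 ->
  (#|J| <= K)%N ->
  (forall j, j \notin J -> exists2 S : {set I}, S \subset J & ~~ small_bias K (j |: S)) ->
  (K + M * ((1 + 2 * K * M) ^ (2 * K) * K) <= #|I|)%N ->
  overlap R q <= 2 ^- K.
Proof.
move=> M0 hM cJ hJ hI.
(* The default can occur only for [j] in [J]. *)
pose S j := odflt set0 [pick S : {set I} | (S \subset J) && ~~ small_bias K (j |: S)].
have SP j : j \notin J -> S j \subset J /\ ~~ small_bias K (j |: S j).
  move=> jJ; rewrite /S; case: pickP => [T /andP[]//|/= h].
  by have [T sT nT] := hJ j jJ; have := h T; rewrite sT nT.
pose r j := subset_sum (j |: S j).
have rq j : quadratic (r j) by apply: quadratic_sum.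
pose Kj j := periods_group [set: gT] (r j).
have [L [s [v [us sA iL cL ss]]]] : exists (L : {group gT}) s v,
    [/\ uniq s, {subset s <= ~: J}, indep Kj L s, (#|gT| <= #|L| * 2 ^ v)%N &
        size s = M * (v + K)]%N.
  (* The search starts from the whole group, so [w = 0]; the price [b = K] pays for guessing the
     values on [J]. *)
  apply: (@independent_family gT I mulgCT Kj (~: J) (2 * K) M K (2 * K) [group of [set: gT]] 0).
  - by move=> j; rewrite inE => /SP[_ /periods_of_large_bias].
  - by rewrite muln1 cardsT.
  - move=> j; rewrite inE => /SP[_ /periods_of_large_bias].
    by rewrite /= setTI cardsT.
  - by have := cardsC J; lia.
(* A component is a guess [T] of the members of [J] that are true, with a coset of [L]. Given [T],
   [q j] is [r j] plus the constant [lam T j]. *)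
pose A := setX (powerset J) (rcosets L [set: gT]).
pose lam (T : {set I}) j := \big[addb/false]_(i in S j) (i \in T).
pose g (c : {set I} * {set gT}) j b :=
  prob R L (fun h => r j (h * repr c.2)%g) (b (+) lam c.1 j).
have g0 c j b : 0 <= g c j b by apply: prob_ge0.
have hrho c j : \sum_b Num.sqrt (g c j b * ber R b) <= rho R.
  under eq_bigr do rewrite /g prob_addb.
  apply: (quadratic_affinity R mulgCT card_gT).
  by apply: quadratic_addb; [apply: quadratic_translate | apply: quadratic_cst].
have sJ j : j \in s -> j \notin J by move/sA; rewrite inE.
have prodE (F : I -> R) : \prod_(j <- s) F j = \prod_(j in [set j in s]) F j.
  by rewrite big_uniq //; apply: eq_bigl => j; rewrite inE.
have rE x j : j \in s -> r j x = q j x (+) lam [set i in J | q i x] j.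
  move=> js; have [sS _] := SP j (sJ j js).
  rewrite /r /subset_sum big_setU1 /=; last by apply: contra (sJ j js); apply: subsetP.
  congr (_ (+) _); apply: eq_bigr => i iS.
  by rewrite inE (subsetP sS).
have G0 : 0 < #|gT|%:R :> R by rewrite card_gT ltr0n expn_gt0.
have law_le z : (\sum_x \prod_(j in [set j in s]) (q j x == z j)%:R) / #|gT|%:R <=
    \sum_(c in A) \prod_(j in [set j in s]) g c j (z j).
  rewrite ler_pdivrMr ?G0 // mulr_suml.
  rewrite (eq_bigl (fun x => x \in [set: gT])); last by move=> x; rewrite inE.
  rewrite (set_partition_big _ (rcosets_partition (subsetT L))) /=.
  have -> : \sum_(c in A) \prod_(j in [set j in s]) g c j (z j) * #|gT|%:R =
      \sum_(T in powerset J) \sum_(c in rcosets L [set: gT])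
        \prod_(j in [set j in s]) g (T, c) j (z j) * #|gT|%:R.
    by rewrite pair_big /=; apply: eq_big => -[T c] //; rewrite in_setX.
  rewrite exchange_big /=; apply: ler_sum => _ /rcosetsP[x0 _ ->].
  set c := (L :* x0)%g.
  apply: (@le_trans _ _ (\sum_(T in powerset J) \sum_(x in c)
      \prod_(j <- s) (r j x == z j (+) lam T j)%:R)).
    rewrite exchange_big /=; apply: ler_sum => x _.
    (* Only the correct guess is used; the others add nonnegative terms. *)
    rewrite (bigD1 [set i in J | q i x]) /=; last first.
      by rewrite inE; apply/subsetP => i; rewrite inE => /andP[].
    rewrite -[leLHS]addr0 lerD ?sumr_ge0 // => [|T _]; last exact: prodr_ge0.
    rewrite prodE; apply: ler_prod => j; rewrite inE => js; rewrite ler0n /= ler_nat.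
    by rewrite rE //; case: (q j x); case: (z j); case: (lam _ _).
  apply: ler_sum => T _.
  rewrite /g /=; set x1 := repr c; rewrite -prodE (reindex_inj (mulIg x1)) /=.
  rewrite (eq_bigl (mem L)) => [|h]; last first.
    have -> : c = (L :* x1)%g by rewrite /x1 rcoset_repr.
    by rewrite mem_rcoset mulgK.
  have inv j : j \in s -> forall x u, u \in Kj j ->
      r j (x * u * x1)%g = r j (x * x1)%g.
    move=> _ x u; rewrite inE => /andP[_ /forall_inP hu].
    by rewrite -mulgA (mulgCT u) mulgA (eqP (hu _ _)) ?inE.
  have := indep_prod R mulgCT (fun j => z j (+) lam T j) iL inv.
  move=> /(canRL (divfK (cardG_neq0 R L))) ->.
  (* The weight [#|L| / #|gT|] of a coset is bounded by 1, which is where the factor [2 ^ v] is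
     lost. *)
  rewrite ler_wpM2l ?ler_nat ?max_card // prodr_ge0 // => j _; exact: prob_ge0.
have := overlap_le g0 law_le (fun c j _ _ => hrho c j).
move=> /le_trans; apply.
rewrite cardsX card_powerset cardsE (card_uniqP us) ss.
have hidx : (#|rcosets L [set: gT]| <= 2 ^ v)%N.
  rewrite -(leq_pmul2l (cardG_gt0 L)) (Lagrange (subsetT L)) ?cardsT //.
(* The family gains [4 ^ (v + K)] against at most [2 ^ (v + K)] components. *)
have h4 : rho R ^+ (M * (v + K)) <= (1 / 4) ^+ (v + K).
  by rewrite exprM lerXn2r ?nnegrE ?exprn_ge0 ?rho_ge0 ?divr_ge0.
have h2 : (2 ^ #|J| * #|rcosets L [set: gT]|)%:R <= 2 ^+ (v + K) :> R.
  rewrite -natrX ler_nat expnD mulnC leq_mul // leq_exp2l //.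
apply: (le_trans (ler_pM _ _ h2 h4)); rewrite ?exprn_ge0 ?rho_ge0 //.
rewrite -exprMn (_ : 2 * (1 / 4) = 2^-1); last by lra.
by rewrite exprVn lef_pV2 ?posrE ?exprn_gt0 // ler_eXn2l ?ltr1n // leq_addl.
Qed.

End Dichotomy.

(** * Choice of parameters *)

Lemma overlap_bound (T : rcfType) (gT : finGroupType) (I : finType) (m M k : nat)
    (q : I -> gT -> bool) :
  commutative (@mulg gT) -> #|gT| = (2 ^ m)%N -> (forall i, quadratic (q i)) ->
  (0 < M)%N -> rho T ^+ M <= 1 / 4 -> (0 < k)%N ->
  (M * k + M * ((1 + 2 * (M * k) * M) ^ (2 * (M * k)) * (M * k)) <= #|I|)%N ->
  overlap T q <= 2 ^- k.
Proof.
move=> mulC cG hq M0 hM k0 hI.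
(* With [K = M * k] the unbiased case gives [2 * 4 ^- k], at most [2 ^- k] since [k] is positive. *)
have [J [hJ cJ [eJ|mx]]] := maximal_unbiased T q (M * k).
  apply: le_trans (overlap_unbiased cG hJ eJ) _; rewrite exprM.
  apply: (@le_trans _ _ (2 * (1 / 4) ^+ k)).
    by rewrite ler_wpM2l // lerXn2r ?nnegrE ?exprn_ge0 ?rho_ge0 ?divr_ge0.
  rewrite (_ : 1 / 4 = 2^-1 * 2^-1); last by lra.
  rewrite exprMn exprVn mulrA ger_pMl ?invr_gt0 ?exprn_gt0 //.
  rewrite ler_pdivrMr ?exprn_gt0 // mul1r -{1}[2]expr1 ler_eXn2l ?ltr1n //.
apply: le_trans (overlap_low_rank mulC cG hq M0 hM cJ mx hI) _.
rewrite lef_pV2 ?posrE ?exprn_gt0 // ler_eXn2l ?ltr1n //.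
by rewrite leq_pmull.
Qed.

(** Bernoulli's inequality gives [(1 + d) ^+ (3 * n) >= 4], and [(1 - d) * (1 + d) <= 1]. *)
Lemma exp_one_sub_inv (T : rcfType) n : (0 < n)%N ->
  (1 - n%:R^-1) ^+ (3 * n) <= 1 / 4 :> T.
Proof.
move=> n0; set d : T := n%:R^-1.
have n0' : 0 < n%:R :> T by rewrite ltr0n.
have d0 : 0 < d by rewrite invr_gt0.
have d1 : d <= 1 by rewrite invf_le1 // ler1n.
have h : 4 <= (1 + d) ^+ (3 * n).
  have bern N : 1 + N%:R * d <= (1 + d) ^+ N.
    elim: N => [|N IH]; first by rewrite mul0r addr0.
    rewrite exprS -addn1 natrD.
    have : 0 <= N%:R :> T by [].
    have : 0 <= (1 + d) * ((1 + d) ^+ N - (1 + N%:R * d)) by rewrite mulr_ge0 ?subr_ge0 //; lra.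
    by nra.
  by apply: le_trans (bern _); rewrite natrM -mulrA divff ?gt_eqF //; lra.
have h' : (1 - d) ^+ (3 * n) * (1 + d) ^+ (3 * n) <= 1.
  by rewrite -exprMn exprn_ile1 //; nra.
have := exprn_ge0 (3 * n) (ltac:(lra) : 0 <= 1 - d).
by move: h h'; set a := (1 + d) ^+ _; set b := (1 - d) ^+ _; nra.
Qed.

Lemma exp_rho (T : rcfType) : exists M, (0 < M)%N /\ rho T ^+ M <= 1 / 4.
Proof.
have [n n0 e] : exists2 n, (0 < n)%N & (1 / 200) ^+ 2 = n%:R^-1 :> T.
  exists (200 * 200)%N; first by rewrite muln_gt0.
  by rewrite natrM invfM div1r expr2.
by exists (3 * n)%N; split; [rewrite muln_gt0 | rewrite /rho e exp_one_sub_inv].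
Qed.

(** Puts the required number of bits in the form [X ^ X] with [X] linear in [k], which is easy to
    invert. *)
Lemma size_bound M k : (0 < M)%N -> (0 < k)%N ->
  (M * k + M * ((1 + 2 * (M * k) * M) ^ (2 * (M * k)) * (M * k))
    <= (3 * (M * M) * k) ^ (3 * (M * M) * k))%N.
Proof.
move=> M0 k0; set X := (3 * (M * M) * k)%N.
have hX : (1 + 2 * (M * k) * M <= X)%N by rewrite /X; nia.
have X0 : (0 < X)%N by lia.
have hY : ((1 + 2 * (M * k) * M) ^ (2 * (M * k)) <= X ^ (2 * (M * k)))%N.
  by rewrite leq_exp2r //; nia.
have Y0 : (0 < X ^ (2 * (M * k)))%N by rewrite expn_gt0 X0.
apply: (@leq_trans (X ^ (2 * (M * k)).+1)); last by rewrite leq_pexp2l //; nia.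
rewrite expnS; set Y := (X ^ _)%N in hY Y0 *; set Z := (_ ^ _)%N in hY *.
have h1 : (M * (Z * (M * k)) <= M * (Y * (M * k)))%N by rewrite leq_mul2l leq_mul2r hY !orbT.
have : (M * k <= M * M * k * Y)%N by nia.
by rewrite /X; nia.
Qed.

(** * From polynomials over F_2 to quadratic Boolean functions *)

Definition quadraticF (F : zmodType) (V : zmodType) (f : V -> F) := forall x y u v,
  f x - f (x + u) - f (x + v) + f (x + u + v) =
  f y - f (y + u) - f (y + v) + f (y + u + v).

Lemma mdegS (m d : nat) (mn : 'X_{1..m}) : mdeg mn = d.+1 ->
  exists i (mn' : 'X_{1..m}), mn = (mn' + U_(i))%MM /\ mdeg mn' = d.
Proof.
move=> h.
have [i hi] : exists i, (0 < mn i)%N.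
  apply/existsP; apply: contraPT h; rewrite negb_exists => /forallP h0.
  rewrite mdegE big1 // => i _; have := h0 i; rewrite lt0n negbK; exact/eqP.
have le : (U_(i) <= mn)%MM by rewrite lep1mP -lt0n.
exists i, (mn - U_(i))%MM; rewrite submK //; split => //.
by move: h; rewrite -{1}(submK le) mdegD mdeg1 addn1 => -[].
Qed.

(** Second differences are linear in [p], so it suffices to check the monomials of degree 0, 1 and
    2. *)
Lemma quadratic_meval (F : comRingType) (m : nat) (p : {mpoly F[m]}) :
  (msize p <= 3)%N -> quadraticF (fun x : 'rV[F]_m => p.@[x 0]).
Proof.
move=> hp x y u v; rewrite !mevalE -!sumrB -!big_split /=.
apply: eq_big_seq => mn hmn; have := leq_trans (msize_mdeg_lt hmn) hp.
rewrite -!mevalX.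
case e : (mdeg mn) => [|[|[|//]]] _.
- by move/eqP: e; rewrite mdeg_eq0 => /eqP ->; rewrite mpolyX0 !meval1; ring.
- have [i [n' [-> /eqP]]] := mdegS e.
  rewrite mdeg_eq0 => /eqP ->; rewrite add0m !mevalXU !mxE; ring.
have [i [n' [-> /mdegS [j [n'' [-> /eqP]]]]]] := mdegS e.
rewrite mdeg_eq0 => /eqP ->.
by rewrite add0m mpolyXD !mevalM !mevalXU !mxE; ring.
Qed.

Section Bits.

Variables (m n : nat) (Q : 'I_n -> {mpoly 'F_2[m]}).

Definition bit (i : 'I_n) (x : 'rV['F_2]_m) : bool := (Q i).@[x 0] == 1.

Lemma F2_cases (a : 'F_2) : a = 0 \/ a = 1.
Proof. by case: a => -[|[|//]] ?; [left|right]; apply: val_inj. Qed.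

Lemma F2_addb (a b : 'F_2) : (a + b == 1) = (a == 1) (+) (b == 1).
Proof. by case: (F2_cases a) => ->; case: (F2_cases b) => ->. Qed.

Lemma F2_opp (a : 'F_2) : - a = a.
Proof. by case: (F2_cases a) => ->; apply/eqP. Qed.

Lemma quadratic_bit i : deg_le2 (Q i) -> quadratic (bit i).
Proof.
move=> /quadratic_meval h x y u v.
by have := h x y u v; rewrite !F2_opp /bit -!F2_addb => ->.
Qed.

Definition bits (y : {ffun 'I_n -> 'F_2}) : {ffun 'I_n -> bool} :=
  [ffun i => y i == 1].

Lemma bits_bij : bijective bits.
Proof.
exists (fun b : {ffun 'I_n -> bool} => [ffun i => if b i then 1 else 0]) => y;
  apply/ffunP => i; rewrite !ffunE; last by case: (y i).
by case: (F2_cases (y i)) => ->.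
Qed.

Lemma card_rV : #|'rV['F_2]_m| = (2 ^ m)%N.
Proof. by rewrite card_mx card_Fp // mul1n. Qed.

Lemma quad_distr_law y : quad_distr Q y = law Rdefinitions.R bit (bits y).
Proof.
rewrite /quad_distr /law card_rV natrX; congr (_ / _).
rewrite -sum1_card natr_sum big_mkcond /=.
rewrite (reindex (fun x : 'rV['F_2]_m => [ffun j => x 0 j])) /=; last first.
  exists (fun f : {ffun 'I_m -> 'F_2} => \row_j f j) => x _.
    by apply/rowP => j; rewrite mxE ffunE.
  by apply/ffunP => j; rewrite ffunE mxE.
apply: eq_bigr => x _; rewrite inE.
have e i : evalF2 (Q i) [ffun j => x 0 j] = (Q i).@[x 0].
  by apply: meval_eq => j; rewrite ffunE.
rewrite (_ : [forall i, _] = ([ffun i => bit i x] == bits y)); first by case: ifP.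
apply/forallP/eqP => h.
  by apply/ffunP => i; rewrite !ffunE /bit -e (eqP (h i)).
move=> i; have := congr1 (fun f : {ffun _ -> _} => f i) h.
rewrite !ffunE e /bit.
by case: (F2_cases (Q i).@[x 0]) => ->; case: (F2_cases (y i)) => ->.
Qed.

Lemma ber13n_law y : ber13n y = ber_law Rdefinitions.R (bits y).
Proof. by apply: eq_bigr => i _; rewrite ffunE. Qed.

End Bits.

(** * Total variation distance as one minus the overlap *)

Lemma tv_dist_min (T : finType) (D1 D2 : T -> Rdefinitions.R) :
  \sum_x D1 x = 1 -> \sum_x D2 x = 1 ->
  tv_dist D1 D2 = 1 - \sum_x Num.min (D1 x) (D2 x).
Proof.
move=> h1 h2; rewrite /tv_dist.
have -> : \sum_x `|D1 x - D2 x| =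
    \sum_x D1 x + \sum_x D2 x - 2 * \sum_x Num.min (D1 x) (D2 x).
  rewrite mulr_sumr -big_split -sumrB /=; apply: eq_bigr => x _.
  by case: (lerP (D1 x) (D2 x)) => _; lra.
have half (F : rcfType) (s : F) : 1 / 2 * (1 + 1 - 2 * s) = 1 - s by lra.
by rewrite h1 h2; apply: half.
Qed.

Lemma sum_law (T : rcfType) (gT : finGroupType) (I : finType) (q : I -> gT -> bool) :
  \sum_y law T q y = 1.
Proof.
rewrite /law -mulr_suml exchange_big /= (eq_bigr (fun=> 1)).
  by rewrite sumr_const divff // pnatr_eq0 -lt0n -cardsT cardG_gt0.
move=> x _; rewrite (bigD1 [ffun i => q i x]) //= eqxx big1 ?addr0 // => y.
by rewrite eq_sym => /negbTE ->.
Qed.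

Lemma sum_ber_law (T : rcfType) (I : finType) :
  \sum_(y : {ffun I -> bool}) ber_law T y = 1.
Proof.
rewrite /ber_law -(bigA_distr_bigA (fun i b => ber T b)) big1 // => i _.
by rewrite big_bool /= /ber; lra.
Qed.

Lemma sum_bits (T : rcfType) n (F : {ffun 'I_n -> bool} -> T) :
  \sum_y F (bits y) = \sum_y F y.
Proof. by rewrite [RHS](reindex (@bits n)) //=; apply: onW_bij; apply: bits_bij. Qed.

Lemma tv_dist_overlap (m n : nat) (Q : 'I_n -> {mpoly 'F_2[m]}) :
  tv_dist (quad_distr Q) (@ber13n n) = 1 - overlap Rdefinitions.R (bit Q).
Proof.
have e := @sum_bits Rdefinitions.R n.
rewrite tv_dist_min.
- rewrite /overlap -e; congr (_ - _); apply: eq_bigr => y _.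
  by rewrite quad_distr_law ber13n_law.
- by rewrite (eq_bigr _ (fun y _ => quad_distr_law Q y)) (e (law Rdefinitions.R (bit Q))) sum_law.
- by rewrite (eq_bigr _ (fun y _ => ber13n_law y)) (e (@ber_law Rdefinitions.R _)) sum_ber_law.
Qed.

Lemma tv_dist_quadratic : exists L, (0 < L)%N /\ forall k m n (Q : 'I_n -> {mpoly 'F_2[m]}),
  (forall i, deg_le2 (Q i)) -> (0 < k)%N -> ((L * k) ^ (L * k) <= n)%N ->
  1 - 2 ^- k <= tv_dist (quad_distr Q) (@ber13n n).
Proof.
have [M [M0 hM]] := exp_rho Rdefinitions.R.
exists (3 * (M * M))%N; split; first by rewrite !muln_gt0 M0.
move=> k m n Q hQ k0 hn; rewrite tv_dist_overlap lerD2l lerN2.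
apply: (@overlap_bound Rdefinitions.R _ _ m M k (bit Q)) => //.
- by move=> x y; apply: addrC.
- exact: card_rV.
- by move=> i; apply: quadratic_bit.
- by rewrite card_ord (leq_trans (size_bound M0 k0)).
Qed.

End QuadraticSources.

(* Real estimates: inverting the size condition *)
From Stdlib Require Import Reals Lra.
Import Num.Theory QuadraticSources.

Lemma log2E x : log2 x = (ln x / ln 2)%R.
Proof. by rewrite /log2 RdivE. Qed.

Lemma log2K x : (log2 x * ln 2 = ln x)%R.
Proof.
by rewrite log2E /Rdiv Rmult_assoc Rinv_l ?Rmult_1_r //; have := ln_lt_2; lra.
Qed.

Lemma ln_lt_id x : (0 < x)%R -> (ln x < x)%R.
Proof.
move=> x0; rewrite -{2}(ln_exp x); apply: ln_increasing => //.
have := exp_ineq1_le x; lra.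
Qed.

Lemma ln_le x y : (0 < x)%R -> (x <= y)%R -> (ln x <= ln y)%R.
Proof. by move=> x0 [h|->]; [left; apply: ln_increasing | right]. Qed.

Lemma exp_le x y : (x <= y)%R -> (exp x <= exp y)%R.
Proof. by case=> [h|->]; [left; apply: exp_increasing | right]. Qed.

(** The upper bound is [ln s < s] at [s = sqrt x]; the factor 4 uses [ln 2 > 1/2]. *)
Lemma log2_le_sqrt x : (2 <= x)%R -> (1 <= log2 x <= 4 * sqrt x)%R.
Proof.
move=> x2; have e := log2K x; have l2 := ln_lt_2.
have s0 : (0 < sqrt x)%R by apply: sqrt_lt_R0; lra.
have hs := ln_lt_id s0.
have es : (ln x = 2 * ln (sqrt x))%R.
  by rewrite -{1}(sqrt_sqrt x) ?ln_mult //; lra.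
have h2 : (ln 2 <= ln x)%R by apply: ln_le; lra.
have h1 : (1 <= log2 x)%R by rewrite -e in h2; nra.
by split => //; nra.
Qed.

Lemma floor_half u : (1 <= u)%R ->
  exists k : nat, [/\ (0 < k)%coq_nat, (INR k <= u)%R & (u <= 2 * INR k)%R].
Proof.
move=> u1; have [lo hi] := base_Int_part u.
have p0 : (0 < Int_part u)%Z by apply: lt_IZR; lra.
have e : INR (Z.to_nat (Int_part u)) = IZR (Int_part u).
  by rewrite INR_IZR_INZ Znat.Z2Nat.id //; apply: Z.lt_le_incl.
have p1 : (1 <= IZR (Int_part u))%R by apply: IZR_le; apply: (Zorder.Zlt_le_succ 0).
exists (Z.to_nat (Int_part u)); rewrite e; split; [|lra|lra].
by apply: INR_lt; rewrite e /=; lra.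
Qed.

(** With [l = log n] and [e = log log n], take for [k] the integer part of [u = l / (e * L)]. Then
    [L * k <= l / e] and [log (L * k) <= e], while [k >= u / 2] gives the constant [1 / (2 * L)]. *)
Lemma choose_exponent (L : nat) : (0 < L)%coq_nat ->
  exists N : nat, forall n : nat, (N <= n)%coq_nat -> exists k : nat,
  [/\ (0 < k)%coq_nat, (INR (L * k) ^ (L * k) <= INR n)%R &
   (exp (- (INR k * ln 2)) <=
      Rpower (INR n) (- (1 / (2 * INR L) / log2 (log2 (INR n)))))%R].
Proof.
move=> L0; exists (Nat.pow 2 (16 * L * L + 2)) => n hn.
have l2 := ln_lt_2.
have L1 : (1 <= INR L)%R by apply: (le_INR 1).
have hn2 : (2 ^ (16 * L * L + 2) <= INR n)%R.
  by have := le_INR _ _ hn; rewrite pow_INR.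
have n0 : (0 < INR n)%R.
  by apply: Rlt_le_trans hn2; apply: pow_lt; lra.
set l := log2 (INR n).
have el : (l * ln 2 = ln (INR n))%R by apply: log2K.
have hl : (16 * INR L * INR L + 2 <= l)%R.
  have : ((16 * INR L * INR L + 2) * ln 2 <= l * ln 2)%R.
    have p2 : (0 < 2 ^ (16 * L * L + 2))%R by apply: pow_lt; lra.
    have := ln_le p2 hn2; rewrite el ln_pow ?plus_INR ?mult_INR /=; last lra.
    lra.
  by nra.
have l2' : (2 <= l)%R by nra.
have [e1 e4] := log2_le_sqrt l2'; have ee := log2K l.
set e := log2 l in e1 e4 ee *.
have s0 := sqrt_pos l; have ss := sqrt_sqrt l ltac:(lra).
have sL : (4 * INR L <= sqrt l)%R by nra.
have hLe : (INR L * e <= l)%R by nra.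
pose u := (l / e / INR L)%R.
have eu : (u * (INR L * e) = l)%R by rewrite /u; field; lra.
have Le0 : (0 < INR L * e)%R by nra.
have u1 : (1 <= u)%R by apply: (Rmult_le_reg_r _ _ _ Le0); lra.
have [k [k0 ku uk]] := floor_half u1.
have k1 : (1 <= INR k)%R by apply: (le_INR 1).
exists k; split => //.
  have x1 : (1 <= INR (L * k))%R by rewrite mult_INR; nra.
  rewrite -Rpower_pow; last lra.
  rewrite -[X in (_ <= X)%R]exp_ln // /Rpower -el.
  have xu : (INR (L * k) * e <= l)%R.
    have : (INR k * (INR L * e) <= u * (INR L * e))%R by apply: Rmult_le_compat_r => //; nra.
    by rewrite mult_INR; lra.
  have xl : (INR (L * k) <= l)%R by nra.
  have hx : (ln (INR (L * k)) <= ln l)%R by apply: ln_le; lra.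
  have : (INR (L * k) * ln (INR (L * k)) <= l * ln 2)%R by rewrite -ee in hx; nra.
  exact: exp_le.
rewrite /Rpower -el.
have -> : (- (1 / (2 * INR L) / e) * (l * ln 2) = - (u / 2 * ln 2))%R.
  by rewrite /u; field; lra.
by apply: exp_le; nra.
Qed.

Section PowersOfTwo.

Local Open Scope ring_scope.

Lemma two_exprVn k : 2 ^- k = exp (- (INR k * ln 2))%R :> R.
Proof.
by rewrite exp_Ropp -RpowE -INRE -Rpower_pow //=; lra.
Qed.

End PowersOfTwo.

Theorem theorem9p1 :
  exists c : R, (0 < c)%R /\
  exists N : nat, forall n : nat, (N <= n)%N ->
  forall (m : nat) (Q : 'I_n -> {mpoly 'F_2[m]}),
    (forall i, deg_le2 (Q i)) ->
    (tv_dist (@quad_distr m n Q) (@ber13n n)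
       >= 1 - Rpower (INR n) (- (c / log2 (log2 (INR n)))))%R.
Proof.
have [L [L0' hL]] := tv_dist_quadratic.
have /ssrnat.ltP L0 := L0'; have [N hN] := choose_exponent L0.
exists (1 / (2 * INR L))%R; split.
  have := lt_INR _ _ L0 => /= h; apply: Rdiv_lt_0_compat; lra.
exists N => n /ssrnat.leP /hN[k [k0' hk hexp]] m Q hQ; have /ssrnat.ltP k0 := k0'.
have hLk : leq (expn (muln L k) (muln L k)) n.
  move: hk; rewrite RpowE INRE INRE -GRing.natrX => /RleP.
  by rewrite ler_nat.
have /RleP := hL k m n Q hQ k0 hLk.
rewrite two_exprVn => h; apply: Rle_ge; apply: Rle_trans h.
by apply: Rplus_le_compat_l; apply: Ropp_le_contravar.
Qed.
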